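(* Let $\mathbb{S}$ and $\mathbb{T}$ be algebraic theories such that: (i) for every $n$-ary operation symbol $\phi_n$ ($n \geq 1$) of $\mathbb{S}$ there is a constant $e_\phi$ of $\mathbb{S}$ which acts as a unit for $\phi_n$: for each $k\le n$, substituting $e_\phi$ for $x_i$ for all $i \neq k$ ($i\le n$) in $\phi_n(x_1,\dots,x_n)$ gives a term provably equal in $\mathbb{S}$ to $x_k$; (ii) for any two $\mathbb{T}$-terms $t_1,t_2$: if $t_1$ contains no variables and $t_1 =_{\mathbb{T}} t_2$, then $t_2$ contains no variables. Assume further that there is an $\mathbb{S}$-term $s$ with at least two free variables. If $\mathbb{T}$ has more than one constant (i.e. two constants not provably equal in $\mathbb{T}$), then there exists no composite theory of $\mathbb{S}$ and $\mathbb{T}$.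
   Context: An algebraic theory $\mathbb{T}$ consists of a signature $\Sigma^{\mathbb{T}}$ of finitary operation symbols (each with an arity in $\mathbb{N}$) and a set $E^{\mathbb{T}}$ of pairs of $\Sigma^{\mathbb{T}}$-terms (axioms), over an infinite supply of variables. A constant is a 0-ary term, i.e. a term containing no variables (for instance a 0-ary operation symbol). $Y \vdash_{\mathbb{T}} t$ means that $t$ is a $\mathbb{T}$-term all of whose variables lie in $Y$. $t_1 =_{\mathbb{T}} t_2$ means the terms are provably equal from the axioms in (standard) equational logic. $t[s_i/x_i]$ denotes simultaneous substitution. Composite theory (separating as $\mathbb{T}$-terms of $\mathbb{S}$-terms): a composite of $\mathbb{S}$ and $\mathbb{T}$ is an algebraic theory $\mathbb{U}$ containing both $\mathbb{S}$ and $\mathbb{T}$ (their operations and axioms) such that: 1. Separation: every $\mathbb{U}$-term $u$ satisfies $u =_{\mathbb{U}} t[s_i/x_i]$ for some $\mathbb{T}$-term $t$ and $\mathbb{S}$-terms $s_i$. 2. Essential uniqueness: whenever $X \vdash_{\mathbb{T}} t$, $X' \vdash_{\mathbb{T}} t'$ and $Y_i\vdash_{\mathbb{S}} s_i$ (for $x_i\in X$), $Y'_{i'}\vdash_{\mathbb{S}} s'_{i'}$ (for $x'_{i'}\in X'$) are such that $t[s_i/x_i] =_{\mathbb{U}} t'[s'_{i'}/x'_{i'}]$, there are a set of variables $Z$ and functions $f: X \to Z$, $f': X' \to Z$ with: (a) $t[f(x_i)/x_i] =_{\mathbb{T}} t'[f'(x'_{i'})/x'_{i'}]$; (b) $f(x_i)=f(x_j)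 \Leftrightarrow s_i =_{\mathbb{S}} s_j$; (c) $f'(x'_{i'})=f'(x'_{j'}) \Leftrightarrow s'_{i'} =_{\mathbb{S}} s'_{j'}$; (d) $f(x_i)=f'(x'_{j'}) \Leftrightarrow s_i =_{\mathbb{S}} s'_{j'}$. *)

(* Defs.v *)
From mathcomp Require Import all_boot.

Set Implicit Arguments.
Unset Strict Implicit.
Unset Printing Implicit Defensive.

Record signature := Signature { op : Type; arity : op -> nat }.

(* The variables are the natural numbers. *)
Inductive term (Sg : signature) : Type :=
| Var (x : nat)
| App (phi : op Sg) (args : 'I_(arity phi) -> term Sg).

Arguments Var {Sg} x.
Arguments App {Sg} phi args.

Fixpoint subst (Sg : signature) (sigma : nat -> term Sg) (t : term Sg)
    : term Sg :=
  match t with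
  | Var x => sigma x
  | App phi args => App phi (fun i => subst sigma (args i))
  end.

Fixpoint occurs (Sg : signature) (x : nat) (t : term Sg) : Prop :=
  match t with
  | Var y => x = y
  | App phi args => exists i, occurs x (args i)
  end.

(* [in_context Y t] is the judgement Y |- t. *)
Definition in_context (Sg : signature) (Y : nat -> Prop) (t : term Sg) : Prop :=
  forall x, occurs x t -> Y x.

(* Constants are arbitrary variable-free terms, not only nullary symbols. *)
Definition is_constant (Sg : signature) (t : term Sg) : Prop :=
  forall x, ~ occurs x t.

Record theory := Theory {
  theory_sig : signature;
  axioms : term theory_sig -> term theory_sig -> Prop
}.

Inductive provable (T : theory) : term (theory_sig T) -> term (theory_sig T) -> Prop :=
| provable_axiom t1 t2 : @axioms T t1 t2 -> provable t1 t2
| provable_refl t : provable t t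
| provable_sym t1 t2 : provable t1 t2 -> provable t2 t1
| provable_trans t1 t2 t3 :
    provable t1 t2 -> provable t2 t3 -> provable t1 t3
| provable_cong (phi : op (theory_sig T)) (a b : 'I_(arity phi) -> term (theory_sig T)) :
    (forall i, provable (a i) (b i)) -> provable (App phi a) (App phi b)
| provable_subst (sigma : nat -> term (theory_sig T)) t1 t2 :
    provable t1 t2 -> provable (subst sigma t1) (subst sigma t2).

Notation "t1 =[ T ] t2" := (@provable T t1 t2)
  (at level 70, T at level 50, no associativity, format "t1  =[ T ]  t2").

(* phi (x_0, ..., x_(n-1)) *)
Definition op_term (Sg : signature) (phi : op Sg) : term Sg :=
  App phi (fun i => Var i).

Definition acts_as_unit (S : theory) (e : term (theory_sig S)) (phi : op (theory_sig S))
    : Prop :=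
  forall k : 'I_(arity phi),
    subst (fun i => if (i < arity phi) && (i != k) then e else Var i)
      (op_term phi) =[S] Var k.

Record sig_inclusion (Sg Sg' : signature) := SigInclusion {
  op_map : op Sg -> op Sg';
  op_map_inj : injective op_map;
  op_map_arity : forall phi, arity (op_map phi) = arity phi
}.

Fixpoint translate (Sg Sg' : signature) (j : sig_inclusion Sg Sg')
    (t : term Sg) : term Sg' :=
  match t with
  | Var x => Var x
  | App phi args =>
      App (op_map j phi)
        (fun i => translate j (args (cast_ord (op_map_arity j phi) i)))
  end.

Definition contains_axioms (S U : theory) (j : sig_inclusion (theory_sig S) (theory_sig U))
    : Prop :=
  forall t1 t2, @axioms S t1 t2 -> @axioms U (translate j t1) (translate j t2).

Section Composite.

Variables (S T U : theory).
Variables (jS : sig_inclusion (theory_sig S) (theory_sig U)).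
Variables (jT : sig_inclusion (theory_sig T) (theory_sig U)).

(* t[s_i/x_i] as a U-term *)
Definition separated (t : term (theory_sig T)) (s : nat -> term (theory_sig S))
    : term (theory_sig U) :=
  subst (fun x => translate jS (s x)) (translate jT t).

Definition separation : Prop :=
  forall u : term (theory_sig U),
  exists (t : term (theory_sig T)) (s : nat -> term (theory_sig S)), u =[U] separated t s.

(* The families s, s', Y, Y' and the functions f, f' are total on variables,
   but only their restrictions to X and X' matter. *)
Definition essential_uniqueness : Prop :=
  forall (X X' : nat -> Prop) (Y Y' : nat -> nat -> Prop)
         (t t' : term (theory_sig T)) (s s' : nat -> term (theory_sig S)),
    in_context X t -> in_context X' t' ->
    (forall x, X x -> in_context (Y x) (s x)) ->
    (forall x, X' x -> in_context (Y' x) (s' x)) ->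
    separated t s =[U] separated t' s' ->
    exists (Z : nat -> Prop) (f f' : nat -> nat),
      (forall x, X x -> Z (f x)) /\
      (forall x, X' x -> Z (f' x)) /\
      subst (fun x => Var (f x)) t =[T] subst (fun x => Var (f' x)) t' /\
      (forall x y, X x -> X y -> (f x = f y <-> s x =[S] s y)) /\
      (forall x y, X' x -> X' y -> (f' x = f' y <-> s' x =[S] s' y)) /\
      (forall x y, X x -> X' y -> (f x = f' y <-> s x =[S] s' y)).

End Composite.

(* The images of S and T in U are not required to be disjoint, and U may have
   further operations and axioms. *)
Definition is_composite (S T U : theory) : Prop :=
  exists (jS : sig_inclusion (theory_sig S) (theory_sig U))
         (jT : sig_inclusion (theory_sig T) (theory_sig U)),
    [/\ contains_axioms jS, contains_axioms jT,
        separation jS jT & essential_uniqueness jS jT].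

(* Main.v *)
Require Import Defs.
From mathcomp Require Import all_boot.

(** An operation [phi] of [S] of arity at least two exists, since a term built
    from operations of arity at most one has at most one variable.  Write
    [phi (a, b)] for [phi (a, b, e, ..., e)] with [e] the unit of [phi].  In a
    composite [U] every constant [c] of [T] is absorbing: separate
    [phi (c, x)] as [t[s_i/x_i]]; putting [x := e] yields
    [c = t[s_i[e/x]/x_i]], so essential uniqueness and (ii) force [t] to be a
    constant equal to [c], whence [phi (c, x) = c].  Likewise [phi (x, d) = d],
    so that [c = phi (c, d) = d] in [U], and essential uniqueness gives [c = d]
    in [T]. *)

Set Implicit Arguments.
Unset Strict Implicit.
Unset Printing Implicit Defensive.

Section Terms.

Variable Sg : signature.
Implicit Type t : term Sg.

Lemma occurs_subst_inv (sigma : nat -> term Sg) t x :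
  occurs x (subst sigma t) -> exists2 y, occurs y t & occurs x (sigma y).
Proof.
elim: t => [y|phi args IH] /=; first by exists y.
by case=> i /IH[y yi xy]; exists y => //; exists i.
Qed.

Lemma occurs_subst (sigma : nat -> term Sg) t x y :
  occurs y t -> occurs x (sigma y) -> occurs x (subst sigma t).
Proof.
elim: t => [z|phi args IH] /=; first by move=> ->.
by case=> i yi xy; exists i; apply: IH.
Qed.

Lemma is_constant_subst (sigma : nat -> term Sg) t :
  is_constant t -> is_constant (subst sigma t).
Proof. by move=> ct x /occurs_subst_inv[y /ct]. Qed.

Lemma is_constant_rename_inv (f : nat -> nat) t :
  is_constant (subst (fun x => Var (f x)) t) -> is_constant t.
Proof. by move=> ct x xt; apply: (ct (f x)); apply: occurs_subst xt _. Qed.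

Lemma occurs_op_term (phi : op Sg) x : occurs x (op_term phi) -> x < arity phi.
Proof. by case=> i /= ->. Qed.

(** Descend while both variables occur in a common argument; at the node where they part, two
    distinct argument positions exist. *)
Lemma two_vars_arity t x y :
  x <> y -> occurs x t -> occurs y t -> exists phi : op Sg, 1 < arity phi.
Proof.
move=> neq; elim: t => [z|phi args IH] /=; first by move=> xz yz; case: neq; rewrite xz.
case=> i xi [j yj]; have [ij|nij] := eqVneq i j.
  by apply: (IH i) => //; rewrite ij.
exists phi; case: (arity phi) i j nij {xi yj IH args} => [[]//|[|//]] i j.
by rewrite (ord1 i) (ord1 j) eqxx.
Qed.

Variables (Sg' : signature) (j : sig_inclusion Sg Sg').

Lemma occurs_translate t x : occurs x (translate j t) -> occurs x t.
Proof. by elim: t => [//|phi args IH] /= [i /IH xi]; eexists; exact: xi. Qed.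

Lemma is_constant_translate t : is_constant t -> is_constant (translate j t).
Proof. by move=> ct x /occurs_translate/ct. Qed.

End Terms.

Section Provability.

Variable U : theory.
Implicit Type t : term (theory_sig U).

Lemma provable_subst_ext (sigma tau : nat -> term (theory_sig U)) t :
  (forall x, occurs x t -> sigma x =[U] tau x) -> subst sigma t =[U] subst tau t.
Proof.
elim: t => [x|phi args IH] /= H; first exact: H.
by apply: provable_cong => i; apply: IH => x xi; apply: H; exists i.
Qed.

(** Arguments of [App] are functions, so Leibniz equality would call for functional extensionality;
    congruence gives provable equality directly. *)
Lemma provable_subst_subst (sigma tau : nat -> term (theory_sig U)) t :
  subst sigma (subst tau t) =[U] subst (fun x => subst sigma (tau x)) t.
Proof.
elim: t => [x|phi args IH] /=; first exact: provable_refl.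
exact: provable_cong.
Qed.

Lemma provable_subst_constant (sigma : nat -> term (theory_sig U)) t :
  is_constant t -> subst sigma t =[U] t.
Proof.
elim: t => [x /(_ x) []//|phi args IH] ct /=; apply: provable_cong => i.
by apply: IH => x xi; apply: (ct x); exists i.
Qed.

Variables (S : theory) (j : sig_inclusion (theory_sig S) (theory_sig U)).

Lemma provable_translate_subst (sigma : nat -> term (theory_sig S))
    (s : term (theory_sig S)) :
  translate j (subst sigma s) =[U]
  subst (fun x => translate j (sigma x)) (translate j s).
Proof.
elim: s => [x|phi args IH] /=; first exact: provable_refl.
by apply: provable_cong => i; apply: IH.
Qed.

Lemma provable_translate (s1 s2 : term (theory_sig S)) :
  contains_axioms j -> s1 =[S] s2 -> translate j s1 =[U] translate j s2.
Proof.
move=> ax; elim=> {s1 s2} [s1 s2 /ax|s|s1 s2 _|s1 s2 s3 _ IH1 _|phi a b _ IH|sigma s1 s2 _ IH].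
- exact: provable_axiom.
- exact: provable_refl.
- exact: provable_sym.
- exact: provable_trans.
- by apply: provable_cong => i; apply: IH.
- apply: provable_trans (provable_translate_subst _ _) _.
  apply: provable_trans (provable_subst _ IH) _.
  exact/provable_sym/provable_translate_subst.
Qed.

Lemma unit_law_translate (e : term (theory_sig S)) (phi : op (theory_sig S))
    (k : 'I_(arity phi)) (w : term (theory_sig U))
    (sigma : nat -> term (theory_sig U)) :
  contains_axioms j -> is_constant e -> acts_as_unit e phi ->
  (forall i, sigma i =[U] (if i == k then w else translate j e)) ->
  subst sigma (translate j (op_term phi)) =[U] w.
Proof.
(* A constant substitution suffices: once the units are inserted, [Var k] is the only variable
   left. *)
move=> ax ce /(_ k)/(provable_translate ax)/(provable_subst (fun=> w)) unit_k Hsigma.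
apply: provable_trans unit_k.
apply: provable_sym; apply: provable_trans.
  exact/provable_subst/provable_translate_subst.
apply: provable_trans (provable_subst_subst _ _ _) _.
(* The bound [ltx] matters: from the arity on, the unit law keeps [Var x], which becomes [w], while
   [sigma x] is the unit. *)
apply: provable_subst_ext => x /occurs_translate/occurs_op_term ltx.
apply: provable_trans (provable_sym (Hsigma x)).
rewrite ltx /=; case: eqP => _ /=; first exact: provable_refl.
exact/provable_subst_constant/is_constant_translate.
Qed.

End Provability.

Section CompositeConstants.

Variables S T U : theory.
Variable jS : sig_inclusion (theory_sig S) (theory_sig U).
Variable jT : sig_inclusion (theory_sig T) (theory_sig U).

Lemma separated_constant (c : term (theory_sig T)) (s : nat -> term (theory_sig S)) :
  is_constant c -> separated jS jT c s =[U] translate jT c.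
Proof. by move=> cc; apply/provable_subst_constant/is_constant_translate. Qed.

Lemma provable_subst_separated (t : term (theory_sig T))
    (s sigma : nat -> term (theory_sig S)) :
  subst (fun x => translate jS (sigma x)) (separated jS jT t s) =[U]
  separated jS jT t (fun x => subst sigma (s x)).
Proof.
apply: provable_trans (provable_subst_subst _ _ _) _.
by apply: provable_subst_ext => x _; apply/provable_sym/provable_translate_subst.
Qed.

Hypothesis uniq_sep : essential_uniqueness jS jT.

Lemma separated_eq_constant (c t : term (theory_sig T)) (s : nat -> term (theory_sig S)) :
    (forall t1 t2 : term (theory_sig T),
       is_constant t1 -> t1 =[T] t2 -> is_constant t2) ->
  is_constant c -> separated jS jT t s =[U] translate jT c ->
  is_constant t /\ c =[T] t.
Proof.
move=> constT cc eq_tc.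
have eq_ct : separated jS jT c s =[U] separated jS jT t s.
  exact: provable_trans (separated_constant _ cc) (provable_sym eq_tc).
(* Being a constant, [c] lives in the empty context; [t] is placed in the context of all variables.
   The renamed terms are then equal in [T], and renaming cannot remove variables. *)
have [//|//|//|//|_ [f [f' [_ [_ [eq_ff' _]]]]]] := uniq_sep (X := fun=> False)
  (X' := fun=> True) (Y := fun _ _ => True) (Y' := fun _ _ => True) _ _ _ _ eq_ct.
have ct : is_constant t.
  apply: (@is_constant_rename_inv _ f'); apply: constT eq_ff'.
  exact: is_constant_subst.
split=> //; apply: provable_trans (provable_sym (provable_subst_constant _ cc)) _.
exact: provable_trans eq_ff' (provable_subst_constant _ ct).
Qed.

Hypothesis axT : contains_axioms jT.
Hypothesis sep : separation jS jT.
Hypothesis constT : forall t1 t2 : term (theory_sig T),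
  is_constant t1 -> t1 =[T] t2 -> is_constant t2.

Lemma translate_constant_inj (c d : term (theory_sig T)) :
  is_constant c -> is_constant d ->
  translate jT c =[U] translate jT d -> c =[T] d.
Proof.
move=> cc cd eq_cd; have [|//] := @separated_eq_constant c d Var constT cc.
exact: provable_trans (separated_constant _ cd) (provable_sym eq_cd).
Qed.

(** Instantiating by [S]-terms changes only the inner terms of a separated form of [u]. Its outer
    [T]-term is thus already a constant equal to [c], and the inner terms disappear. *)
Lemma constant_of_S_instance (c : term (theory_sig T)) (u : term (theory_sig U))
    (sigma : nat -> term (theory_sig S)) :
  is_constant c ->
  subst (fun x => translate jS (sigma x)) u =[U] translate jT c ->
  u =[U] translate jT c.
Proof.
move=> cc eq_uc; have [t [s eq_u]] := sep u.
have [||ct eq_ct] := @separated_eq_constant c t (fun x => subst sigma (s x)) constT => //.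
  apply: provable_trans eq_uc; apply: provable_sym.
  exact: provable_trans (provable_subst _ eq_u) (provable_subst_separated _ _ _).
apply: provable_trans eq_u _; apply: provable_trans (separated_constant _ ct) _.
exact/provable_sym/provable_translate.
Qed.

Hypothesis axS : contains_axioms jS.

Lemma constant_absorbing (phi : op (theory_sig S)) (e : term (theory_sig S))
    (c : term (theory_sig T)) (k : 'I_(arity phi))
    (sigma : nat -> term (theory_sig U)) :
  is_constant e -> acts_as_unit e phi -> is_constant c ->
  sigma k = translate jT c ->
  subst sigma (translate jS (op_term phi)) =[U] translate jT c.
Proof.
move=> ce unit_e cc sigma_k.
(* The generic case: [c] in position [k], variables elsewhere. Sending these variables to [e] yields
   [c] by the unit law. *)
pose x_c (i : nat) := if i == k then translate jT c else Var i.
have phi_c : subst x_c (translate jS (op_term phi)) =[U] translate jT c.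
  apply: (@constant_of_S_instance _ _ (fun=> e)) => //.
  apply: provable_trans (provable_subst_subst _ _ _) _.
  apply: (unit_law_translate (k := k) axS ce unit_e) => i; rewrite /x_c.
  case: eqP => _; last exact: provable_refl.
  exact/provable_subst_constant/is_constant_translate.
(* An arbitrary [sigma] with [c] at [k] is [x_c] followed by [sigma], up to provability, and [sigma]
   fixes the constant [c]. *)
apply: provable_trans
  (provable_trans (provable_subst sigma phi_c) (provable_subst_constant _ _)).
  apply: provable_sym; apply: provable_trans (provable_subst_subst _ _ _) _.
  apply: provable_subst_ext => i _; rewrite /x_c.
  case: eqP => [->|_]; last exact: provable_refl.
  by rewrite sigma_k; apply/provable_subst_constant/is_constant_translate.
exact: is_constant_translate.
Qed.

End CompositeConstants.

Theorem corollary4p7 (S T : theory)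
  (unitS : forall phi : op (theory_sig S), 0 < arity phi ->
     exists e : term (theory_sig S), is_constant e /\ acts_as_unit e phi)
  (constT : forall t1 t2 : term (theory_sig T),
     is_constant t1 -> t1 =[T] t2 -> is_constant t2)
  (two_varsS : exists (s : term (theory_sig S)) (x y : nat),
     [/\ x <> y, occurs x s & occurs y s])
  (two_constsT : exists c d : term (theory_sig T),
     [/\ is_constant c, is_constant d & ~ c =[T] d]) :
  ~ exists U : theory, is_composite S T U.
Proof.
case=> U [jS [jT [axS axT sep uniq_sep]]].
case: two_varsS => s [x [y [neq_xy xs ys]]].
have [phi gt1] := two_vars_arity neq_xy xs ys.
have [e [ce unit_e]] := unitS phi (ltnW gt1).
case: two_constsT => c [d [cc cd]]; case.
apply: (translate_constant_inj uniq_sep constT) => //.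
(* One term, absorbed by [c] at position 0 and by [d] at position 1. Absorption allows any further
   arguments, so these are simply [d] instead of the unit. *)
pose cd_args (i : nat) := if i == 0 then translate jT c else translate jT d.
have absorb := constant_absorbing uniq_sep axT sep constT axS
  (sigma := cd_args) ce unit_e.
apply: provable_trans (provable_sym (absorb c (Ordinal (ltnW gt1)) cc erefl)) _.
exact: absorb d (Ordinal gt1) cd erefl.
Qed.
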